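(* Let $n\ge1$ and let $f:(0,+\infty)\to(0,+\infty)$ be a Borel function. Then $$f(\Psi_1(A))=\Psi_1(f(A))\quad\text{for all }A\in\mathscr{P}_n(\mathbb{C}),\qquad f(\Psi_2(B))=\Psi_2(f(B))\quad\text{for all }B\in\mathscr{P}_n(\mathbb{H}).$$
   Context: For $\mathbb{D}\in\{\mathbb{R},\mathbb{C},\mathbb{H}\}$, $A^*$ is the conjugate transpose of $A\in\mathrm{Mat}_n(\mathbb{D})$, and $\mathscr{P}_n(\mathbb{D})$ is the set of $A\in\mathrm{Mat}_n(\mathbb{D})$ with $A=A^*$ and $x^*Ax>0$ for all nonzero $x\in\mathbb{D}^n$. Every $X\in\mathscr{P}_n(\mathbb{D})$ can be written $X=U\Lambda U^*$ with $\Lambda=\mathrm{diag}(\lambda_1,\dots,\lambda_n)$, $\lambda_i>0$ real, and $U\in\mathrm{GL}_n(\mathbb{D})$ with $UU^*=\mathrm{Id}_n$ (i.e. $U\in\mathrm{O}(n),\mathrm{U}(n),\mathrm{Sp}(n)$ respectively), and one sets $f(X)=U\,\mathrm{diag}(f(\lambda_1),\dots,f(\lambda_n))\,U^*$. The maps $\Psi_1:\mathrm{Mat}_n(\mathbb{C})\to\mathrm{Mat}_{2n}(\mathbb{R})$ and $\Psi_2:\mathrm{Mat}_n(\mathbb{H})\to\mathrm{Mat}_{2n}(\mathbb{C})$ are $\Psi_1(A+iB)=\begin{pmatrix}A&B\\-B&A\end{pmatrix}$ ($A,B\in\mathrm{Mat}_n(\mathbb{R})$) and $\Psi_2(Z_1+Z_2j)=\begin{pmatrix}Z_1&Z_2\\-\overline{Z_2}&\overline{Z_1}\end{pmatrix}$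 ($Z_1,Z_2\in\mathrm{Mat}_n(\mathbb{C})$, using $\mathbb{H}=\mathbb{C}\oplus\mathbb{C}j$). They map $\mathscr{P}_n(\mathbb{C})$ into $\mathscr{P}_{2n}(\mathbb{R})$ and $\mathscr{P}_n(\mathbb{H})$ into $\mathscr{P}_{2n}(\mathbb{C})$. *)

(* Defs.v *)
From HB Require Import structures.
From mathcomp Require Import all_boot all_order all_algebra.
From mathcomp Require Import all_classical all_reals all_analysis.
From mathcomp.real_closed Require Import complex.
From mathcomp Require Import ring.

Set Implicit Arguments.
Unset Strict Implicit.
Unset Printing Implicit Defensive.

Import Order.TTheory GRing.Theory Num.Theory.
Local Open Scope ring_scope.
Local Open Scope complex_scope.
Local Open Scope classical_set_scope.

(* Quaternions as H = C (+) C j: [Quat a b] stands for a + b j, so that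
   j^2 = -1 and j c = conj(c) j for every complex c. *)
Record quat (R : realType) : Type := Quat { qfst : R[i]; qsnd : R[i] }.

Section QuaternionRing.
Variable R : realType.
Local Notation H := (quat R).
Implicit Types p q r : H.

Definition pair_of_quat q : R[i] * R[i] := (qfst q, qsnd q).
Definition quat_of_pair (z : R[i] * R[i]) : H := Quat z.1 z.2.

Lemma pair_of_quatK : cancel pair_of_quat quat_of_pair.
Proof. by case. Qed.

HB.instance Definition _ := Choice.copy H (can_type pair_of_quatK).

Definition zeroq : H := Quat 0 0.
Definition oneq : H := Quat 1 0.
Definition oppq q : H := Quat (- qfst q) (- qsnd q).
Definition addq p q : H := Quat (qfst p + qfst q) (qsnd p + qsnd q).
Definition mulq p q : H :=
  Quat (qfst p * qfst q - qsnd p * conjc (qsnd q))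
       (qfst p * qsnd q + qsnd p * conjc (qfst q)).

Lemma addqA : associative addq.
Proof. by move=> [a b] [c d] [e g]; rewrite /addq /= !addrA. Qed.
Lemma addqC : commutative addq.
Proof.
by move=> [a b] [c d]; rewrite /addq /= (addrC a) (addrC b).
Qed.
Lemma add0q : left_id zeroq addq.
Proof. by move=> [a b]; rewrite /addq /= !add0r. Qed.
Lemma addNq : left_inverse zeroq oppq addq.
Proof. by move=> [a b]; rewrite /addq /= !addNr. Qed.

HB.instance Definition _ := GRing.isZmodule.Build H addqA addqC add0q addNq.

Lemma mulqA : associative mulq.
Proof.
move=> [a b] [c d] [e g]; rewrite /mulq /=.
by congr Quat; rewrite !(rmorphD, rmorphN, rmorphM) /= !conjcK; ring.
Qed.
Lemma mul1q : left_id oneq mulq.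
Proof. by move=> [a b]; rewrite /mulq /= !mul1r !mul0r subr0 addr0. Qed.
Lemma mulq1 : right_id oneq mulq.
Proof.
move=> [a b]; rewrite /mulq [qfst oneq]/= [qsnd oneq]/= conjc0 conjc1.
by rewrite !mulr1 !mulr0 subr0 add0r.
Qed.
Lemma mulqDl : left_distributive mulq addq.
Proof.
by move=> [a b] [c d] [e g]; rewrite /mulq /addq /=; congr Quat; ring.
Qed.
Lemma mulqDr : right_distributive mulq addq.
Proof.
move=> [a b] [c d] [e g]; rewrite /mulq /addq /=.
by congr Quat; rewrite !rmorphD /=; ring.
Qed.
Lemma oneq_neq0 : oneq != zeroq.
Proof. by apply/eqP => -[/eqP]; rewrite oner_eq0. Qed.

HB.instance Definition _ := GRing.Zmodule_isNzRing.Build H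
  mulqA mul1q mulq1 mulqDl mulqDr oneq_neq0.

(* j^* = - j, hence (b j)^* = j^* b^* = - j conj(b) = - b j. *)
Definition conjq q : H := Quat (conjc (qfst q)) (- qsnd q).

End QuaternionRing.

(* The scalars D together with their conjugation and the inclusion of the
   (central) real numbers; the three instances below are R, C and H. *)
Record scalars (R : realType) := Scalars {
  scalar_ring :> nzRingType;
  sconj : scalar_ring -> scalar_ring;
  of_real : R -> scalar_ring }.

Definition real_scalars (R : realType) : scalars R :=
  @Scalars R R (fun x => x) (fun x => x).
Definition complex_scalars (R : realType) : scalars R :=
  @Scalars R R[i] (@conjc R) (fun x => x%:C).
Definition quat_scalars (R : realType) : scalars R :=
  @Scalars R (quat R) (@conjq R) (fun x => Quat x%:C 0).

Section FunctionalCalculus.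
Variables (R : realType) (D : scalars R).

Definition ctransmx (m n : nat) (A : 'M[D]_(m, n)) : 'M[D]_(n, m) :=
  map_mx (@sconj R D) A^T.

(* For D = C and D = H, the inequality x^* A x > 0 means that the scalar
   x^* A x is a positive real number. *)
Definition posdefmx (n : nat) (A : 'M[D]_n) : Prop :=
  A = ctransmx A /\
  forall x : 'cV[D]_n, x != 0 ->
    exists2 r : R, 0 < r & (ctransmx x *m A *m x) 0 0 = of_real D r.

(* [unitmx] is only available over commutative rings. *)
Definition invertiblemx (n : nat) (U : 'M[D]_n) : Prop :=
  exists V : 'M[D]_n, U *m V = 1%:M /\ V *m U = 1%:M.

Definition unitary_group (n : nat) : set 'M[D]_n :=
  [set U | invertiblemx U /\ U *m ctransmx U = 1%:M].

Definition real_diag_mx (n : nat) (l : 'rV[R]_n) : 'M[D]_n :=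
  diag_mx (map_mx (of_real D) l).

Definition fcalc_values (n : nat) (f : R -> R) (X : 'M[D]_n) : set 'M[D]_n :=
  [set Y | exists (U : 'M[D]_n) (l : 'rV[R]_n),
    [/\ unitary_group U,
        forall i, 0 < l 0 i,
        X = U *m real_diag_mx l *m ctransmx U &
        Y = U *m real_diag_mx (map_mx f l) *m ctransmx U]].

(* f(X).  For X positive definite, [fcalc_values f X] is a singleton; the
   default value 0 is only returned when X has no such diagonalization. *)
Definition fcalc (n : nat) (f : R -> R) (X : 'M[D]_n) : 'M[D]_n :=
  xget 0 (fcalc_values f X).

End FunctionalCalculus.

Definition Psi1 (R : realType) (n : nat) (Z : 'M[R[i]]_n) : 'M[R]_(n + n) :=
  let A := map_mx (@complex.Re R) Z in
  let B := map_mx (@complex.Im R) Z in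
  block_mx A B (- B) A.

Definition Psi2 (R : realType) (n : nat) (Q : 'M[quat R]_n) :
    'M[R[i]]_(n + n) :=
  let Z1 := map_mx (@qfst R) Q in
  let Z2 := map_mx (@qsnd R) Q in
  block_mx Z1 Z2 (- map_mx conjc Z2) (map_mx conjc Z1).

(* Main.v *)
Require Import Defs.
From mathcomp Require Import all_boot all_order all_algebra.
From mathcomp Require Import all_classical all_reals all_analysis.
From mathcomp.real_closed Require Import complex.
From mathcomp Require Import ring.

Set Implicit Arguments.
Unset Strict Implicit.
Unset Printing Implicit Defensive.

Import Order.TTheory GRing.Theory Num.Theory.
Local Open Scope ring_scope.
Local Open Scope complex_scope.
Local Open Scope classical_set_scope.

(** A diagonalization pins down f(X). If U L U^* = V M V^* with U, V unitary and
L, M real diagonal, then W = V^* U satisfies M W = W L, that is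
m_i w_ij = w_ij l_j; real scalars being central, every nonzero w_ij forces
m_i = l_j, hence f(m_i) w_ij = w_ij f(l_j), and so U f(L) U^* = V f(M) V^*
([fcalc_values_unique]). Therefore it is enough to carry one diagonalization of
X to one of Psi X, and this holds for every multiplicative unital map that
commutes with conjugate transposition and sends real diagonal matrices to real
diagonal matrices compatibly with f ([fcalc_values_embed]); both Psi1 and Psi2
have these properties, each diagonal entry being doubled.

The argument still needs every positive definite matrix over C and H to have a
diagonalization, for otherwise the functional calculus on the left could be
nontrivial while the one on the right takes its default value. Over C this is
the spectral theorem for Hermitian matrices. Over H it is deduced from the
complex one ([quat_spectral]): as a right complex vector space H^n is C^2n, on
which B acts as Psi2 B, so a complex eigenbasis of Psi2 B is a family of
quaternionic eigenvectors of B with real eigenvalues. An orthonormal family of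
eigenvectors, the columns of Q, is enlarged one vector at a time: the projection
P = 1 - Q Q^* commutes with B and is nonzero while the family is not complete,
so it maps some member of the eigenbasis to a nonzero eigenvector orthogonal to
Q. Positivity of the eigenvalues is read off from x^* X x at the columns of U
([posdef_diag_gt0]). *)

(** * Scalars with an involution and central reals *)

(** The common algebra of R, C and H. [of_real_inj] is the form of cancellation
needed for the uniqueness of f(X), and avoids inverses in H. *)
Record star_scalars (R : realType) (D : scalars R) : Prop := StarScalars {
  sconjD : {morph @sconj R D : x y / x + y};
  sconjM : forall x y : D, sconj (x * y) = sconj y * sconj x;
  sconjK : involutive (@sconj R D);
  of_real1 : of_real D 1 = 1;
  of_realM : {morph @of_real R D : x y / x * y};
  of_real_conj : forall a, sconj (of_real D a) = of_real D a;
  of_realC : forall a (x : D), of_real D a * x = x * of_real D a;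
  of_real_inj : forall a b (x : D), x != 0 ->
    of_real D a * x = of_real D b * x -> a = b }.

Arguments sconjD {R D}.
Arguments sconjM {R D}.
Arguments sconjK {R D}.
Arguments of_real1 {R D}.
Arguments of_realM {R D}.
Arguments of_real_conj {R D}.
Arguments of_realC {R D}.
Arguments of_real_inj {R D} _ {a b x}.

(** * Conjugate transposition and uniqueness of the functional calculus *)

Section ConjugateTranspose.
Variables (R : realType) (D : scalars R) (starD : star_scalars D).

Lemma sconj0 : @sconj R D 0 = 0.
Proof. by apply: (addrI (sconj 0)); rewrite -(sconjD starD) !addr0. Qed.

Lemma ctransmxK m n : cancel (@ctransmx R D m n) (@ctransmx R D n m).
Proof. by move=> A; apply/matrixP => i j; rewrite !mxE sconjK. Qed.

Lemma ctransmx_mul m n p (A : 'M[D]_(m, n)) (B : 'M[D]_(n, p)) :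
  ctransmx (A *m B) = ctransmx B *m ctransmx A.
Proof.
apply/matrixP => i j; rewrite !mxE.
rewrite (big_morph _ (sconjD starD) sconj0).
by apply: eq_bigr => k _; rewrite !mxE sconjM.
Qed.

Lemma ctransmx_row m n1 n2 (A : 'M[D]_(m, n1)) (B : 'M[D]_(m, n2)) :
  ctransmx (row_mx A B) = col_mx (ctransmx A) (ctransmx B).
Proof. by rewrite /ctransmx tr_row_mx map_col_mx. Qed.

Lemma ctransmx_real_diag n (l : 'rV[R]_n) :
  ctransmx (real_diag_mx D l) = real_diag_mx D l.
Proof.
apply/matrixP => i j; rewrite !mxE.
have [->|neq_ij] := eqVneq i j; first by rewrite of_real_conj.
exact: sconj0.
Qed.

Lemma mul_real_diag n (l m : 'rV[R]_n) :
  real_diag_mx D l *m real_diag_mx D m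
  = real_diag_mx D (\row_i (l 0 i * m 0 i)).
Proof.
rewrite /real_diag_mx mul_mx_diag; apply/matrixP => i j; rewrite !mxE.
have [->|_] := eqVneq i j; first by rewrite of_realM.
by rewrite !mulr0n mul0r.
Qed.

Lemma real_diag1 n : real_diag_mx D (const_mx 1 : 'rV[R]_n) = 1%:M.
Proof. by rewrite /real_diag_mx map_const_mx of_real1 // diag_const_mx. Qed.

Lemma unitary_groupP n (U : 'M[D]_n) :
  unitary_group U <-> U *m ctransmx U = 1%:M /\ ctransmx U *m U = 1%:M.
Proof.
split=> [[[V [UV VU]] UU]|[UU UU']]; last by split=> //; exists (ctransmx U).
suff <- : V = ctransmx U by [].
by rewrite -[V]mulmx1 -UU mulmxA VU mul1mx.
Qed.

(** An entry W i j that is nonzero makes the eigenvalues m i and l j equal, so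
intertwining is preserved when f is applied to both sides. *)
Lemma real_diag_intertwine n (f : R -> R) (l m : 'rV[R]_n) (W : 'M[D]_n) :
  real_diag_mx D m *m W = W *m real_diag_mx D l ->
  real_diag_mx D (map_mx f m) *m W = W *m real_diag_mx D (map_mx f l).
Proof.
move/matrixP=> mW; apply/matrixP => i j; have := mW i j.
rewrite /real_diag_mx !mul_diag_mx !mul_mx_diag !mxE.
have [->|W0] := eqVneq (W i j) 0; first by rewrite !mulr0 !mul0r.
by rewrite -!(of_realC starD) => /(of_real_inj starD W0) ->.
Qed.

(** Two diagonalizations differ by the unitary W = V^* U, which intertwines the
two diagonal matrices. *)
Lemma fcalc_values_unique n (f : R -> R) (X Y Z : 'M[D]_n) :
  fcalc_values f X Y -> fcalc_values f X Z -> Y = Z.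
Proof.
move=> [U [l [/unitary_groupP[UU UU'] _ XU ->]]].
move=> [V [m [/unitary_groupP[VV VV'] _ XV ->]]].
pose W := ctransmx V *m U.
have UE : U = V *m W by rewrite mulmxA VV mul1mx.
have /(real_diag_intertwine f) mW :
    real_diag_mx D m *m W = W *m real_diag_mx D l.
  have := congr1 (fun X => ctransmx V *m X *m U) (etrans (esym XU) XV).
  by rewrite -!mulmxA UU' mulmx1 !mulmxA VV' mul1mx => ->.
by rewrite {1}UE -[V *m W *m _]mulmxA -mW -!mulmxA UU mulmx1.
Qed.

Lemma fcalcE n (f : R -> R) (X Y : 'M[D]_n) :
  fcalc_values f X Y -> fcalc f X = Y.
Proof.
by move=> XY; apply: xget_unique => // Z /fcalc_values_unique; apply.
Qed.

(** The i-th eigenvalue is x^* X x for x the i-th column of U. *)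
Lemma posdef_diag_gt0 n (X U : 'M[D]_n) (l : 'rV[R]_n) :
  posdefmx X -> unitary_group U -> X = U *m real_diag_mx D l *m ctransmx U ->
  forall i, 0 < l 0 i.
Proof.
move=> [_ Xpos] /unitary_groupP[_ UU'] XE i.
have Ui0 : col i U != 0.
  apply/eqP => Ui0; have /matrixP/(_ i i) := UU'.
  rewrite mxE big1 => [|k _].
    by move=> /esym/eqP; rewrite mxE eqxx oner_eq0.
  by have /colP/(_ k) := Ui0; rewrite !mxE => ->; rewrite mulr0.
have xXx : (ctransmx (col i U) *m X *m col i U) 0 0 = of_real D (l 0 i).
  have -> : ctransmx (col i U) = row i (ctransmx U).
    by apply/matrixP => a b; rewrite !mxE.
  rewrite -row_mul; transitivity ((ctransmx U *m X *m U) i i).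
    by rewrite [LHS]mxE [RHS]mxE; apply: eq_bigr => k _; rewrite !mxE.
  rewrite XE !mulmxA UU' mul1mx -mulmxA UU' mulmx1.
  by rewrite !mxE eqxx mulr1n.
have [r r_gt0] := Xpos _ Ui0; rewrite xXx -[LHS]mulr1 -[RHS]mulr1.
by move=> /(of_real_inj starD (oner_neq0 D)) ->.
Qed.

End ConjugateTranspose.

(** * Transport along involution-preserving embeddings *)

Lemma fcalc_values_embed (R : realType) (D E : scalars R)
    n p (psi : 'M[D]_n -> 'M[E]_p) (dup : 'rV[R]_n -> 'rV[R]_p) :
  (forall A B, psi (A *m B) = psi A *m psi B) ->
  psi 1%:M = 1%:M ->
  (forall A, psi (ctransmx A) = ctransmx (psi A)) ->
  (forall l, psi (real_diag_mx D l) = real_diag_mx E (dup l)) ->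
  (forall l : 'rV[R]_n, (forall i, 0 < l 0 i) -> forall i, 0 < dup l 0 i) ->
  (forall f l, dup (map_mx f l) = map_mx f (dup l)) ->
  forall f X Y, fcalc_values f X Y -> fcalc_values f (psi X) (psi Y).
Proof.
move=> psiM psi1 psiT psiD dup_gt0 dup_map f X Y.
move=> [U [l [/unitary_groupP[UU UU'] l_gt0 -> ->]]].
exists (psi U), (dup l); split.
- by apply/unitary_groupP; rewrite -psiT -!psiM UU UU' psi1.
- exact: dup_gt0.
- by rewrite !psiM psiT psiD.
- by rewrite !psiM psiT psiD dup_map.
Qed.

Lemma row_mx_dup_gt0 (R : realType) n (l : 'rV[R]_n) :
  (forall i, 0 < l 0 i) -> forall i, 0 < row_mx l l 0 i.
Proof. by move=> l_gt0 i; rewrite mxE; case: splitP => k _. Qed.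

(** * The three scalar rings *)

Section ScalarInstances.
Variable R : realType.

Lemma real_star_scalars : star_scalars (real_scalars R).
Proof.
split=> //=; first by move=> x y; rewrite mulrC.
  by move=> a x; rewrite mulrC.
by move=> a b x x0; apply: mulIf.
Qed.

Lemma complex_star_scalars : star_scalars (complex_scalars R).
Proof.
split=> //=.
- by move=> x y; rewrite rmorphD.
- by move=> x y; rewrite rmorphM mulrC.
- exact: conjcK.
- by move=> x y; rewrite rmorphM.
- exact: conjc_real.
- by move=> a x; rewrite mulrC.
- by move=> a b x x0 /(mulIf x0) [].
Qed.

Lemma QuatM (a b c d : R[i]) :
  Quat a b * Quat c d
  = Quat (a * c - b * conjc d) (a * d + b * conjc c) :> quat R.
Proof. by []. Qed.

Lemma conjqM (p q : quat R) : conjq (p * q) = conjq q * conjq p.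
Proof.
case: p q => [a b] [c d]; rewrite !QuatM /conjq /=.
by congr Quat; rewrite ?(rmorphB, rmorphM, rmorphN) /= !conjcK; ring.
Qed.

Lemma mul_real_quat (a : R) (c d : R[i]) :
  Quat a%:C 0 * Quat c d = Quat (a%:C * c) (a%:C * d) :> quat R.
Proof. by rewrite QuatM !mul0r subr0 addr0. Qed.

Lemma quat_star_scalars : star_scalars (quat_scalars R).
Proof.
split=> //=.
- move=> [a b] [c d]; congr Quat; first by rewrite rmorphD.
  by rewrite opprD.
- exact: conjqM.
- by move=> [a b]; rewrite /conjq /= conjcK opprK.
- by move=> x y; rewrite mul_real_quat rmorphM mulr0.
- by move=> a; congr Quat; [exact: conjc_real | exact: oppr0].
- move=> a [b c]; rewrite mul_real_quat QuatM conjc0 conjc_real.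
  by congr Quat; ring.
- move=> a b [c d] x0; rewrite !mul_real_quat => -[].
  have [c0|c0] := eqVneq c 0; last by move=> /(mulIf c0)[].
  move=> _; have [d0|d0] := eqVneq d 0; last by move=> /(mulIf d0)[].
  by move: x0; rewrite c0 d0 eqxx.
Qed.

End ScalarInstances.

(** * The real representation of complex matrices *)

Section RealRepresentation.
Variable R : realType.

Lemma map_Re_mul m n p (Z : 'M[R[i]]_(m, n)) (W : 'M[R[i]]_(n, p)) :
  map_mx (@complex.Re R) (Z *m W) =
    map_mx (@complex.Re R) Z *m map_mx (@complex.Re R) W
    - map_mx (@complex.Im R) Z *m map_mx (@complex.Im R) W.
Proof.
apply/matrixP => i j; rewrite !mxE (raddf_sum (@complex.Re R)) -sumrB.
by apply: eq_bigr => k _; rewrite !mxE; case: (Z i k) (W k j) => [a b] [c d].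
Qed.

Lemma map_Im_mul m n p (Z : 'M[R[i]]_(m, n)) (W : 'M[R[i]]_(n, p)) :
  map_mx (@complex.Im R) (Z *m W) =
    map_mx (@complex.Re R) Z *m map_mx (@complex.Im R) W
    + map_mx (@complex.Im R) Z *m map_mx (@complex.Re R) W.
Proof.
apply/matrixP => i j; rewrite !mxE (raddf_sum (@complex.Im R)) -big_split.
by apply: eq_bigr => k _; rewrite !mxE; case: (Z i k) (W k j) => [a b] [c d].
Qed.

Lemma Psi1_mul n (Z W : 'M[R[i]]_n) : Psi1 (Z *m W) = Psi1 Z *m Psi1 W.
Proof.
rewrite /Psi1 mulmx_block map_Re_mul map_Im_mul.
by rewrite !(mulmxN, mulNmx) opprD [in X in block_mx _ _ X]addrC
           [in X in block_mx _ _ _ X]addrC.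
Qed.

Lemma Psi1_ctrans n (Z : 'M[R[i]]_n) :
  Psi1 (ctransmx (D := complex_scalars R) Z)
  = ctransmx (D := real_scalars R) (Psi1 Z).
Proof.
have -> : ctransmx (D := real_scalars R) (Psi1 Z) = (Psi1 Z)^T.
  by apply/matrixP => i j; rewrite !mxE.
rewrite /Psi1 tr_block_mx.
by congr block_mx; apply/matrixP => i j; rewrite !mxE;
   case: (Z j i) => //= a b; rewrite ?opprK.
Qed.

Lemma Psi1_real_diag n (l : 'rV[R]_n) :
  Psi1 (real_diag_mx (complex_scalars R) l)
  = real_diag_mx (real_scalars R) (row_mx l l).
Proof.
rewrite /real_diag_mx map_row_mx diag_mx_row /Psi1.
congr block_mx; apply/matrixP => i j; rewrite !mxE /=;
  by case: (i == j); rewrite ?oppr0.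
Qed.

Lemma Psi1_1 n : Psi1 1%:M = 1%:M :> 'M[R]_(n + n).
Proof.
rewrite -(real_diag1 (complex_star_scalars R)) Psi1_real_diag row_mx_const.
exact: real_diag1 (real_star_scalars R) _.
Qed.

Lemma fcalc_values_Psi1 n f (X Y : 'M[R[i]]_n) :
  fcalc_values (D := complex_scalars R) f X Y ->
  fcalc_values (D := real_scalars R) f (Psi1 X) (Psi1 Y).
Proof.
apply: (fcalc_values_embed (D := complex_scalars R) (E := real_scalars R)
          (dup := fun l => row_mx l l)).
- exact: Psi1_mul.
- exact: Psi1_1.
- exact: Psi1_ctrans.
- exact: Psi1_real_diag.
- exact: row_mx_dup_gt0.
- by move=> g l; rewrite map_row_mx.
Qed.

End RealRepresentation.

(** * Diagonalization over the complex numbers *)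

Section ComplexSpectralTheorem.
Variables (R : realType) (n : nat).
Local Notation C := (complex_scalars R).

Lemma complex_spectral (A : 'M[R[i]]_n) :
  A = ctransmx (D := C) A -> exists (U : 'M[C]_n) (l : 'rV[R]_n),
    unitary_group U /\ A = U *m real_diag_mx C l *m ctransmx U.
Proof.
move=> AA; pose P := spectralmx A.
have Aherm : A \is hermsymmx.
  by apply/is_hermitianmxP; rewrite expr0 scale1r {1}AA.
have PP : P *m ctransmx (D := C) P = 1%:M.
  exact: (unitarymxP (spectral_unitarymx A)).
have PP' : ctransmx (D := C) P *m P = 1%:M by apply: mulmx1C.
have CP : ctransmx (ctransmx (D := C) P) = P.
  exact: ctransmxK (complex_star_scalars R) _ _ _.
exists (ctransmx (D := C) P), (map_mx (@complex.Re R) (spectral_diag A)).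
split; first by apply/unitary_groupP; rewrite CP.
rewrite CP [LHS](orthomx_spectralP (hermitian_normalmx Aherm)).
congr (_ *m _ *m _); first exact/invmx_unitary/spectral_unitarymx.
congr diag_mx; apply/rowP => i; rewrite !mxE.
by have /mxOverP/(_ 0 i)/RRe_real := hermitian_spectral_diag_real Aherm.
Qed.

End ComplexSpectralTheorem.

(** * The complex representation of quaternionic matrices *)

Section QuaternionRepresentation.
Variable R : realType.
Local Notation H := (quat_scalars R).
Local Notation C := (complex_scalars R).
Let starH := quat_star_scalars R.
Let starC := complex_star_scalars R.

(** The map Psi2 extended to rectangular matrices, so that it also applies to
column vectors and to incomplete orthonormal families. *)
Definition quat_block m n (Q : 'M[quat R]_(m, n)) : 'M[R[i]]_(m + m, n + n) :=
  let Z1 := map_mx (@qfst R) Q in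
  let Z2 := map_mx (@qsnd R) Q in
  block_mx Z1 Z2 (- map_mx conjc Z2) (map_mx conjc Z1).

Lemma map_qfst_mul m n p (P : 'M[quat R]_(m, n)) (Q : 'M[quat R]_(n, p)) :
  map_mx (@qfst R) (P *m Q) = map_mx (@qfst R) P *m map_mx (@qfst R) Q
    - map_mx (@qsnd R) P *m map_mx conjc (map_mx (@qsnd R) Q).
Proof.
apply/matrixP => i j; rewrite !mxE.
rewrite (big_morph (@qfst R) (id1 := 0) (op1 := +%R)) // -sumrB.
by apply: eq_bigr => k _; rewrite !mxE.
Qed.

Lemma map_qsnd_mul m n p (P : 'M[quat R]_(m, n)) (Q : 'M[quat R]_(n, p)) :
  map_mx (@qsnd R) (P *m Q) = map_mx (@qfst R) P *m map_mx (@qsnd R) Q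
    + map_mx (@qsnd R) P *m map_mx conjc (map_mx (@qfst R) Q).
Proof.
apply/matrixP => i j; rewrite !mxE.
rewrite (big_morph (@qsnd R) (id1 := 0) (op1 := +%R)) // -big_split.
by apply: eq_bigr => k _; rewrite !mxE.
Qed.

Lemma quat_block_mul m n p (P : 'M[quat R]_(m, n)) (Q : 'M[quat R]_(n, p)) :
  quat_block (P *m Q) = quat_block P *m quat_block Q.
Proof.
have conjK m' n' (A : 'M[R[i]]_(m', n')) : map_mx conjc (map_mx conjc A) = A.
  by apply/matrixP => i j; rewrite !mxE conjcK.
rewrite /quat_block mulmx_block map_qfst_mul map_qsnd_mul.
have conjM m' n' p' (A : 'M[R[i]]_(m', n')) (A' : 'M[R[i]]_(n', p')) :
    map_mx conjc (A *m A') = map_mx conjc A *m map_mx conjc A'.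
  exact: map_mxM.
rewrite map_mxD map_mxB !conjM !conjK !(mulmxN, mulNmx).
by rewrite opprD [in X in block_mx _ _ X]addrC
           [in X in block_mx _ _ _ X]addrC.
Qed.

Lemma quat_block_ctrans m n (Q : 'M[quat R]_(m, n)) :
  quat_block (ctransmx (D := H) Q) = ctransmx (D := C) (quat_block Q).
Proof.
rewrite /ctransmx /quat_block tr_block_mx map_block_mx.
by congr block_mx; apply/matrixP => i j;
   rewrite !mxE //= ?conjcK // rmorphN /= ?opprK ?conjcK.
Qed.

Lemma quat_block_real_diag n (l : 'rV[R]_n) :
  quat_block (real_diag_mx H l) = real_diag_mx C (row_mx l l).
Proof.
rewrite /real_diag_mx map_row_mx diag_mx_row /quat_block.
congr block_mx; apply/matrixP => i j; rewrite !mxE;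
  case: (i == j) => //; rewrite ?mulr1n ?mulr0n /= ?conjc0 ?oppr0 //.
Qed.

Lemma quat_block1 n : quat_block 1%:M = 1%:M :> 'M[R[i]]_(n + n).
Proof.
rewrite -(real_diag1 starH) quat_block_real_diag row_mx_const.
exact: real_diag1 starC _.
Qed.

Lemma fcalc_values_Psi2 n f (X Y : 'M[quat R]_n) :
  fcalc_values (D := H) f X Y ->
  fcalc_values (D := C) f (Psi2 X) (Psi2 Y).
Proof.
apply: (fcalc_values_embed (D := H) (E := C) (dup := fun l => row_mx l l)).
- exact: quat_block_mul.
- exact: quat_block1.
- exact: quat_block_ctrans.
- exact: quat_block_real_diag.
- exact: row_mx_dup_gt0.
- by move=> g l; rewrite map_row_mx.
Qed.

(** The identification of H^m with C^2m as right complex vector spaces, applied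
column by column: a + b j is sent to (a, - conj b). The left half of the block
matrix is the one on which Psi2 P acts as P does ([quat_cols_mul]). *)
Definition quat_cols m n (Q : 'M[quat R]_(m, n)) : 'M[R[i]]_(m + m, n) :=
  lsubmx (quat_block Q).

Definition quat_of_cols m n (W : 'M[R[i]]_(m + m, n)) : 'M[quat R]_(m, n) :=
  \matrix_(i, j) Quat (usubmx W i j) (- conjc (dsubmx W i j)).

Lemma quat_colsK m n : cancel (@quat_cols m n) (@quat_of_cols m n).
Proof.
move=> Q; apply/matrixP => i j; rewrite mxE /quat_cols /quat_block.
rewrite block_mxEh row_mxKl col_mxKu col_mxKd !mxE rmorphN /= conjcK opprK.
by case: (Q i j).
Qed.

Lemma quat_of_colsK m n : cancel (@quat_of_cols m n) (@quat_cols m n).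
Proof.
move=> W; rewrite /quat_cols /quat_block block_mxEh row_mxKl -[RHS]vsubmxK.
by congr col_mx; apply/matrixP => i j; rewrite !mxE //= rmorphN /= conjcK opprK.
Qed.

Lemma quat_cols_mul m n p (P : 'M[quat R]_(m, n)) (Q : 'M[quat R]_(n, p)) :
  quat_cols (P *m Q) = quat_block P *m quat_cols Q.
Proof.
rewrite /quat_cols quat_block_mul -[in LHS](hsubmxK (quat_block Q)).
by rewrite mul_mx_row row_mxKl.
Qed.

Lemma quat_cols_mul_diag m n (Q : 'M[quat R]_(m, n)) (l : 'rV[R]_n) :
  quat_cols (Q *m real_diag_mx H l) = quat_cols Q *m real_diag_mx C l.
Proof.
rewrite /quat_cols quat_block_mul quat_block_real_diag.
rewrite -[in LHS](hsubmxK (quat_block Q)) /real_diag_mx map_row_mx diag_mx_row.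
by rewrite mul_row_block row_mxKl mulmx0 addr0.
Qed.

Lemma quat_cols0 m n : quat_cols (0 : 'M[quat R]_(m, n)) = 0.
Proof.
rewrite -[RHS]quat_of_colsK; congr quat_cols; apply/matrixP => i j.
by rewrite !mxE conjc0 oppr0.
Qed.

(** One-sided inverses are two-sided over C, and the complex representation is
faithful. *)
Lemma mulmx1_quatC n (P Q : 'M[quat R]_n) : P *m Q = 1%:M -> Q *m P = 1%:M.
Proof.
move=> PQ; apply: (can_inj (@quat_colsK n n)); congr lsubmx.
rewrite quat_block_mul quat_block1; apply: mulmx1C.
by rewrite -quat_block_mul PQ quat_block1.
Qed.

(** The rank of the complex representation, of size 2n by 2k, is at most 2k. *)
Lemma quat_coisometry_leq n k (Q : 'M[quat R]_(n, k)) :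
  Q *m ctransmx (D := H) Q = 1%:M -> (n <= k)%N.
Proof.
move=> QQ; rewrite -leq_double -!addnn.
have := congr1 (@quat_block n n) QQ; rewrite quat_block_mul quat_block1 => QQC.
rewrite -{1}(mxrank1 R[i] (n + n)) -QQC (leq_trans (mxrankM_maxl _ _)) //.
exact: rank_leq_col.
Qed.

(** The scalar q^* q is the sum of the squares of the 4n real coordinates
of q. *)
Lemma quat_norm_gt0 n (q : 'cV[quat R]_n) : q != 0 ->
  exists2 s : R, 0 < s & ctransmx (D := H) q *m q = real_diag_mx H (const_mx s).
Proof.
move=> q0.
pose sq (z : R[i]) := complex.Re z ^+ 2 + complex.Im z ^+ 2.
pose N (x : quat R) := sq (qfst x) + sq (qsnd x).
have sq_ge0 z : 0 <= sq z by rewrite addr_ge0 ?sqr_ge0.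
have sq_eq0 z : sq z = 0 -> z = 0.
  move=> /eqP; rewrite paddr_eq0 ?sqr_ge0 // !sqrf_eq0.
  by case: z => a b /= /andP[/eqP-> /eqP->].
have N_ge0 x : 0 <= N x by rewrite addr_ge0.
have N_eq0 x : N x = 0 -> x = 0.
  move=> /eqP; rewrite paddr_eq0 //; case: x => a b /=.
  by move=> /andP[/eqP/sq_eq0-> /eqP/sq_eq0->].
have conjqE x : conjq x * x = Quat (N x)%:C 0.
  case: x => [[a b] [c d]]; rewrite /conjq QuatM /N /sq /=.
  congr Quat; simpc; congr (_ +i* _); ring.
exists (\sum_i N (q i 0)).
  rewrite lt_def sumr_ge0 // andbT; apply: contra q0.
  rewrite psumr_eq0 // => /allP q0; apply/eqP/colP => i.
  by rewrite mxE; apply/N_eq0/eqP/q0; rewrite mem_index_enum.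
apply/matrixP => i j; rewrite !ord1 !mxE eqxx mulr1n.
rewrite (big_morph (of_real H) (id1 := 0) (op1 := +%R)) //=; last first.
  by move=> x y; rewrite rmorphD; congr Quat; rewrite addr0.
by apply: eq_bigr => k _; rewrite !mxE conjqE.
Qed.

(** * Diagonalization over the quaternions *)

Lemma col_mul (T : nzRingType) m n p (A : 'M[T]_(m, n)) (B : 'M[T]_(n, p)) j :
  col j (A *m B) = A *m col j B.
Proof. by rewrite !colE mulmxA. Qed.

(** The new column is the normalized projection, orthogonal to the columns of Q,
of a suitable member of a complex eigenbasis of the representation of B. *)
Lemma quat_isometry_extend n k (B : 'M[quat R]_n) (Q : 'M[quat R]_(n, k))
    (l : 'rV[R]_k) :
  B = ctransmx (D := H) B ->
  ctransmx (D := H) Q *m Q = 1%:M -> B *m Q = Q *m real_diag_mx H l ->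
  (k < n)%N ->
  exists (Q' : 'M[quat R]_(n, 1 + k)) (l' : 'rV[R]_(1 + k)),
    ctransmx (D := H) Q' *m Q' = 1%:M /\ B *m Q' = Q' *m real_diag_mx H l'.
Proof.
move=> BB QQ BQ lt_kn.
have BCH : quat_block B = ctransmx (D := C) (quat_block B).
  by rewrite -quat_block_ctrans -BB.
have [W [m [/unitary_groupP[WW WW'] BW]]] := complex_spectral BCH.
pose P : 'M[quat R]_n := 1%:M - Q *m ctransmx (D := H) Q.
have QP : ctransmx (D := H) Q *m P = 0.
  by rewrite mulmxBr mulmx1 mulmxA QQ mul1mx subrr.
have QB : ctransmx (D := H) Q *m B = real_diag_mx H l *m ctransmx (D := H) Q.
  rewrite -(ctransmx_real_diag starH) -(ctransmx_mul starH) -BQ.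
  by rewrite (ctransmx_mul starH) -BB.
have BP : B *m P = P *m B.
  by rewrite mulmxBr mulmxBl mulmx1 mul1mx mulmxA BQ -!mulmxA QB.
have P0 : P != 0.
  apply/eqP => /subr0_eq/esym/quat_coisometry_leq.
  by rewrite leqNgt lt_kn.
pose V := P *m quat_of_cols W.
have BV : B *m V = V *m real_diag_mx H m.
  rewrite mulmxA BP -!mulmxA; congr (_ *m _).
  apply: (can_inj (@quat_colsK _ _)).
  rewrite quat_cols_mul quat_cols_mul_diag quat_of_colsK BW.
  by rewrite -!mulmxA WW' mulmx1.
have V0 : V != 0.
  apply: contra P0 => /eqP V0.
  (* W is invertible, so P cannot annihilate all members of the eigenbasis. *)
  have PW : quat_block P *m W = 0.
    by rewrite -(quat_of_colsK W) -quat_cols_mul -/V V0 quat_cols0.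
  apply/eqP/(can_inj (@quat_colsK _ _)); rewrite quat_cols0 /quat_cols.
  by rewrite -[quat_block P]mulmx1 -WW mulmxA PW mul0mx linear0.
have [j q0] : exists j, col j V != 0.
  apply/existsP; apply: contraNT V0; rewrite negb_exists => /forallP Vj0.
  apply/eqP/matrixP => a j; move/eqP/colP: (negbNE (Vj0 j)) => /(_ a).
  by rewrite !mxE.
have [s s_gt0 qq] := quat_norm_gt0 q0.
pose q := col j V *m real_diag_mx H (const_mx (Num.sqrt s)^-1 : 'rV_1).
have q_norm : ctransmx (D := H) q *m q = 1%:M.
  rewrite (ctransmx_mul starH) (ctransmx_real_diag starH) mulmxA.
  rewrite -[_ *m _ *m col j V]mulmxA qq !(mul_real_diag starH).
  rewrite -(real_diag1 starH); congr real_diag_mx; apply/rowP => i.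
  have s0 : Num.sqrt s != 0 by rewrite gt_eqF ?sqrtr_gt0.
  by rewrite !mxE -{2}(sqr_sqrtr (ltW s_gt0)); field.
have Qq : ctransmx (D := H) Q *m q = 0.
  by rewrite mulmxA -col_mul mulmxA QP !mul0mx col0 mul0mx.
have qQ : ctransmx (D := H) q *m Q = 0.
  rewrite -(ctransmxK starH Q) -(ctransmx_mul starH) Qq.
  by apply/matrixP => a b; rewrite !mxE sconj0.
have Bq : B *m q = q *m real_diag_mx H (const_mx (m 0 j)).
  have colD : col j (V *m real_diag_mx H m)
              = col j V *m real_diag_mx H (const_mx (m 0 j) : 'rV_1).
    by rewrite /real_diag_mx !mul_mx_diag; apply/matrixP => a b; rewrite !mxE.
  rewrite mulmxA -col_mul BV colD -!mulmxA !(mul_real_diag starH).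
  apply: (congr1 (fun d => col j V *m real_diag_mx H d)).
  by apply/rowP => a; rewrite !mxE mulrC.
exists (row_mx q Q), (row_mx (const_mx (m 0 j) : 'rV_1) l); split.
  rewrite ctransmx_row mul_col_row q_norm qQ Qq QQ.
  by rewrite -scalar_mx_block.
rewrite mul_mx_row Bq BQ /real_diag_mx map_row_mx diag_mx_row mul_row_block.
by rewrite !mulmx0 addr0 add0r.
Qed.

(** Orthonormal families of eigenvectors exist in every size k <= n; for k = n
such a family is a unitary matrix. *)
Lemma quat_spectral n (B : 'M[quat R]_n) :
  B = ctransmx (D := H) B -> exists (U : 'M[H]_n) (l : 'rV[R]_n),
    unitary_group U /\ B = U *m real_diag_mx H l *m ctransmx U.
Proof.
move=> BB; suff [Q [l [QQ BQ]]] : exists (Q : 'M[H]_n) (l : 'rV[R]_n),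
    ctransmx Q *m Q = 1%:M /\ B *m Q = Q *m real_diag_mx H l.
  have QQ' : Q *m ctransmx Q = 1%:M by apply: mulmx1_quatC.
  by exists Q, l; split; [apply/unitary_groupP|rewrite -BQ -mulmxA QQ' mulmx1].
suff eigen_isometry k : (k <= n)%N ->
    exists (Q : 'M[H]_(n, k)) (l : 'rV[R]_k),
      ctransmx Q *m Q = 1%:M /\ B *m Q = Q *m real_diag_mx H l.
  exact: eigen_isometry (leqnn n).
elim: k => [_|k IHk lt_kn].
  exists 0, 0; split; first by rewrite [LHS]flatmx0 [RHS]flatmx0.
  by rewrite [LHS]thinmx0 [RHS]thinmx0.
have [Q [l [QQ BQ]]] := IHk (ltnW lt_kn).
exact: quat_isometry_extend BB QQ BQ lt_kn.
Qed.

End QuaternionRepresentation.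

(** * The functional calculus commutes with both representations *)

(* f : (0,+oo) -> (0,+oo) is given by a total function R -> R, of which only
   the values on (0,+oo) are constrained (and used). *)
Theorem lemma2p11 (R : realType) (n : nat) (hn : (1 <= n)%N) (f : R -> R)
    (f_pos : forall x : R, 0 < x -> 0 < f x)
    (f_borel : measurable_fun (`]0, +oo[ : set R) f) :
  (forall A : 'M[R[i]]_n, posdefmx (D := complex_scalars R) A ->
     fcalc (D := real_scalars R) f (Psi1 A)
     = Psi1 (fcalc (D := complex_scalars R) f A)) /\
  (forall B : 'M[quat R]_n, posdefmx (D := quat_scalars R) B ->
     fcalc (D := complex_scalars R) f (Psi2 B)
     = Psi2 (fcalc (D := quat_scalars R) f B)).
Proof.
have starR := real_star_scalars R; have starC := complex_star_scalars R.
have starH := quat_star_scalars R.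
split=> [A posA|B posB].
  have [U [l [UU AE]]] := complex_spectral posA.1.
  have l_gt0 := posdef_diag_gt0 starC posA UU AE.
  set Y := U *m real_diag_mx (complex_scalars R) (map_mx f l) *m ctransmx U.
  have AY : fcalc_values (D := complex_scalars R) f A Y by exists U, l.
  by rewrite (fcalcE starC AY); apply/(fcalcE starR)/fcalc_values_Psi1.
have [U [l [UU BE]]] := quat_spectral posB.1.
have l_gt0 := posdef_diag_gt0 starH posB UU BE.
set Y := U *m real_diag_mx (quat_scalars R) (map_mx f l) *m ctransmx U.
have BY : fcalc_values (D := quat_scalars R) f B Y by exists U, l.
by rewrite (fcalcE starH BY); apply/(fcalcE starC)/fcalc_values_Psi2.
Qed.
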